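(* For any configuration $W\subseteq V=\mathbb{C}^E$, the automorphisms $m$ and $\hat m$ induce isomorphisms $$m\colon(\mathbb{P}W)^\circ\times(\mathbb{P}W^\perp)^\circ\to\Lambda_W^\circ,\qquad \hat m\colon W^\circ\times(W^\perp)^\circ\to\hat\Lambda_W^\circ.$$ If $\mathsf{M}_W$ is a connected matroid, then $\Lambda_W^\circ\subseteq\mathbb{T}_E\times\mathbb{T}_{E^\star}$ is a smooth very affine variety whose closure $\Lambda_W^{\mathrm{irr}}$ in $\mathbb{P}V\times\mathbb{P}V^\star$ equals $\Lambda_W$.
   Context: $E=\{1,\dots,n\}$, $V=\mathbb{C}^E$ has basis $x_1,\dots,x_n$, and $V^\star$ has the dual basis $y_1,\dots,y_n$. For $v\in V$ put $v_i=y_i(v)$; for $\beta\in V^\star$ put $\beta_i=\beta(x_i)$. $\mathbb{P}V$ denotes the space of lines in $V$. A configuration is a linear subspace $W\subseteq V$; $r=\dim W$, and it is assumed that $n>r>0$. Its matroid $\mathsf{M}_W$ on $E$ has as bases those $B\subseteq E$ for which the coordinate projection $W\to\mathbb{C}^B$ is an isomorphism. $W^\perp=(V/W)^\star\subseteq V^\star$ is the annihilator of $W$. Put $\ell_i=y_i|_W$. $\hat{\mathbb{T}}_E\subseteq V$ and $\hat{\mathbb{T}}_{E^\star}\subseteq V^\star$ are the tori where all coordinates are nonzero, and $\mathbb{T}_E\subseteq\mathbb{P}V$, $\mathbb{T}_{E^\star}\subseteq\mathbb{P}V^\star$ their images. $W^\circ=W\cap\hat{\mathbb{T}}_E$, $(W^\perp)^\circ=W^\perp\cap\hat{\mathbb{T}}_{E^\star}$,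 $(\mathbb{P}W)^\circ=\mathbb{P}W\cap\mathbb{T}_E$, $(\mathbb{P}W^\perp)^\circ=\mathbb{P}W^\perp\cap\mathbb{T}_{E^\star}$. $\hat\Lambda_W\subseteq W\times V^\star\subseteq V\times V^\star$ is the scheme of pairs $(w,\beta)$ with $\sum_{i\in E}\beta_iw_i\ell_i=0$ in $W^\star$, and $\Lambda_W\subseteq\mathbb{P}W\times\mathbb{P}V^\star\subseteq\mathbb{P}V\times\mathbb{P}V^\star$ is defined by the same bihomogeneous equations. $\hat\Lambda_W^\circ=\hat\Lambda_W\cap(\hat{\mathbb{T}}_E\times\hat{\mathbb{T}}_{E^\star})$ and $\Lambda_W^\circ=\Lambda_W\cap(\mathbb{T}_E\times\mathbb{T}_{E^\star})$. $\hat{\mathbb{T}}_E$ acts on $V$ coordinatewise and on $V^\star$ contragrediently, $(u\beta)(v)=\beta(u^{-1}v)$, so $(u\beta)_i=\beta_i/u_i$. $\hat m$ is the automorphism $(u,\beta)\mapsto(u,u\beta)$ of $\hat{\mathbb{T}}_E\times\hat{\mathbb{T}}_{E^\star}$, and $m$ is the induced automorphism of $\mathbb{T}_E\times\mathbb{T}_{E^\star}$. A very affine variety is a closed irreducible subvariety of an algebraic torus. *)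

(* Defs.v *)
From HB Require Import structures.
From mathcomp Require Import all_boot all_order all_algebra.
From mathcomp Require Import reals.
From mathcomp Require Import complex mpoly.

Set Implicit Arguments.
Unset Strict Implicit.
Unset Printing Implicit Defensive.

Import GRing.Theory.
Local Open Scope ring_scope.

(** V = F^n and its dual are both 'rV[F]_n, in the coordinates given by the
    basis x_1, ..., x_n of V and its dual basis y_1, ..., y_n.

    Schemes over F are described by their functors of points: a subscheme of
    V, or of V x V^*, is given by its A-valued points for every commutative
    F-algebra A.  (Asking A to be a unit ring only equips it with a test for
    invertibility and an inverse; classically every commutative ring has
    these.)

    A subscheme of PV x PV^* is given in the same way by homogeneous
    coordinates: an A-point is then a pair of unimodular vectors, taken up to
    scaling of either vector by a unit of A ([proj_eq]).  These are the
    A-points at which both tautological line bundles are trivial.  Every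
    A-point is of this kind locally on Spec A, so they determine subschemes.
    The A-points of the tori in PV and PV^* are exactly the unit vectors
    modulo units, since the character lattice of the torus of PV is a direct
    summand of Z^n. *)

Section Matroid.

Definition coord_proj (F : fieldType) (n : nat) (W : {vspace 'rV[F]_n})
    (B : {set 'I_n}) (w : subvs_of W) : {ffun {i | i \in B} -> F} :=
  [ffun i => vsval w 0 (val i)].

Definition config_basis (F : fieldType) (n : nat) (W : {vspace 'rV[F]_n})
    (B : {set 'I_n}) : Prop :=
  bijective (@coord_proj F n W B).

(** A matroid on a nonempty ground set, given by its bases, is connected when
    it is not the direct sum of matroids on two nonempty complementary
    subsets.  If the bases decompose as below, then [b1] and [b2] are
    automatically the bases of matroids on S and its complement. *)
Definition matroid_connected (n : nat) (bases : {set 'I_n} -> Prop) : Prop :=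
  ~ exists (S : {set 'I_n}) (b1 b2 : {set 'I_n} -> Prop),
      [/\ S != set0, ~: S != set0,
          forall B, b1 B -> B \subset S,
          forall B, b2 B -> B \subset ~: S
        & forall B, bases B <->
            exists B1 B2, [/\ b1 B1, b2 B2 & B = B1 :|: B2]].

End Matroid.

Section Points.
Variables (F : fieldType) (n : nat).

Definition points (A : comUnitAlgType F) : Type := ('rV[A]_n * 'rV[A]_n)%type.

Definition subfunctor1 : Type := forall A : comUnitAlgType F, 'rV[A]_n -> Prop.
Definition subfunctor : Type := forall A : comUnitAlgType F, points A -> Prop.

Definition torus : subfunctor1 :=
  fun A v => forall i, v 0 i \is a GRing.unit.

Definition unimodular : subfunctor1 :=
  fun A v => exists a : 'rV[A]_n, \sum_i a 0 i * v 0 i = 1.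

Definition cap1 (X Y : subfunctor1) : subfunctor1 := fun A v => X A v /\ Y A v.
Definition cap (X Y : subfunctor) : subfunctor := fun A p => X A p /\ Y A p.
Definition prod_sub (X Y : subfunctor1) : subfunctor :=
  fun A p => X A p.1 /\ Y A p.2.

Definition annihilator (W : {vspace 'rV[F]_n}) (g : 'rV[F]_n) : Prop :=
  forall v, v \in W -> \sum_i g 0 i * v 0 i = 0.

Definition W_points (W : {vspace 'rV[F]_n}) : subfunctor1 :=
  fun A w => forall g, annihilator W g -> \sum_i g 0 i *: w 0 i = 0.

Definition Wperp_points (W : {vspace 'rV[F]_n}) : subfunctor1 :=
  fun A b => forall v, v \in W -> \sum_i v 0 i *: b 0 i = 0.

Definition W_circ (W : {vspace 'rV[F]_n}) : subfunctor1 :=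
  cap1 (W_points W) torus.
Definition Wperp_circ (W : {vspace 'rV[F]_n}) : subfunctor1 :=
  cap1 (Wperp_points W) torus.

(** The element \sum_i b_i w_i l_i of W^* (x) A vanishes iff its values on
    all v in W vanish, and l_i (v) = v_i. *)
Definition Lambda_hat (W : {vspace 'rV[F]_n}) : subfunctor :=
  fun A p => W_points W p.1 /\
    forall v, v \in W -> \sum_i v 0 i *: (p.2 0 i * p.1 0 i) = 0.

Definition Lambda_hat_circ (W : {vspace 'rV[F]_n}) : subfunctor :=
  cap (Lambda_hat W) (prod_sub torus torus).

(** Homogeneous coordinates of the points of Lambda_W in PV x PV^*. *)
Definition Lambda (W : {vspace 'rV[F]_n}) : subfunctor :=
  cap (Lambda_hat W) (prod_sub unimodular unimodular).

Definition Lambda_circ (W : {vspace 'rV[F]_n}) : subfunctor :=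
  cap (Lambda W) (prod_sub torus torus).

(** (PW)^o and (PW^perp)^o in homogeneous coordinates. *)
Definition PW_circ (W : {vspace 'rV[F]_n}) : subfunctor1 :=
  cap1 (cap1 (W_points W) unimodular) torus.
Definition PWperp_circ (W : {vspace 'rV[F]_n}) : subfunctor1 :=
  cap1 (cap1 (Wperp_points W) unimodular) torus.

Definition points_rel : Type :=
  forall A : comUnitAlgType F, points A -> points A -> Prop.

Definition affine_eq : points_rel := fun A p q => p = q.

Definition proj_eq : points_rel :=
  fun A p q => exists c d : A,
    [/\ c \is a GRing.unit, d \is a GRing.unit & q = (c *: p.1, d *: p.2)].

Definition dual_act (A : comUnitAlgType F) (u b : 'rV[A]_n) : 'rV[A]_n :=
  \row_i (b 0 i / u 0 i).

(** The action map (u, b) |-> (u, u b); this formula gives m-hat on vectors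
    and, on homogeneous coordinates, m. *)
Definition act_map (A : comUnitAlgType F) (p : points A) : points A :=
  (p.1, dual_act p.1 p.2).

(** By Yoneda, a map given by ring operations is an isomorphism of schemes
    from X to Y iff it is bijective on A-points for all A.  Here A-points are
    taken up to [e]. *)
Definition induces_iso (e : points_rel)
    (f : forall A : comUnitAlgType F, points A -> points A)
    (X Y : subfunctor) : Prop :=
  forall A : comUnitAlgType F,
    [/\ forall p, X A p -> Y A (f A p),
        forall p q, X A p -> X A q -> e A p q -> e A (f A p) (f A q),
        forall p q, X A p -> X A q -> e A (f A p) (f A q) -> e A p q
      & forall q, Y A q -> exists2 p, X A p & e A (f A p) q].

(** The polynomial ring on V x V^*: the first n variables are the coordinates
    on V, the last n those on V^*. *)
Definition poly_eval (A : comUnitAlgType F) (f : {mpoly F[n + n]})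
    (p : points A) : A :=
  mmap (GRing.in_alg A) (fun k => row_mx p.1 p.2 0 k) f.

(** When X is stable under [proj_eq], this ideal is bihomogeneous. *)
Definition ideal_of (X : subfunctor) (f : {mpoly F[n + n]}) : Prop :=
  forall (A : comUnitAlgType F) (p : points A), X A p -> poly_eval f p = 0.

Definition zero_locus (I : {mpoly F[n + n]} -> Prop) : subfunctor :=
  fun A p => forall f, I f -> poly_eval f p = 0.

(** Closed subschemes of the torus in PV x PV^* correspond to the
    bihomogeneous ideals of the Laurent polynomial ring in 2n variables, hence
    to bihomogeneous ideals of the polynomial ring that are saturated by the
    variables; the closed subscheme is integral iff the ideal is prime. *)
Definition very_affine_variety (X : subfunctor) : Prop :=
  [/\ forall (A : comUnitAlgType F) (p : points A),
        X A p <-> prod_sub torus torus p /\ zero_locus (ideal_of X) p,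
      ~ ideal_of X 1
    & forall f g, ideal_of X (f * g) -> ideal_of X f \/ ideal_of X g].

(** The infinitesimal lifting property.  For a scheme of finite type over F,
    such as a closed subscheme of the torus, it defines smoothness. *)
Definition smooth_over_base (e : points_rel) (X : subfunctor) : Prop :=
  forall (A B : comUnitAlgType F) (pi : {lrmorphism A -> B}),
    (forall b : B, exists a : A, pi a = b) ->
    (forall a a' : A, pi a = 0 -> pi a' = 0 -> a * a' = 0) ->
    forall q : points B, X B q ->
      exists2 p : points A, X A p & e B (map_mx pi p.1, map_mx pi p.2) q.

(** Scheme-theoretic closure in PV x PV^*. *)
Definition proj_closure (X : subfunctor) : subfunctor :=
  cap (zero_locus (ideal_of X)) (prod_sub unimodular unimodular).

Definition same_subscheme (X Y : subfunctor) : Prop :=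
  forall (A : comUnitAlgType F) (p : points A), X A p <-> Y A p.

End Points.

(* Main.v *)
From HB Require Import structures.
Require Import Defs.
From mathcomp Require Import all_boot all_order all_algebra.
From mathcomp Require Import reals.
From mathcomp Require Import complex mpoly.
From mathcomp Require Import ring zify.

(** Since (u, b) |-> (u, b / u) turns the equation b w = 0 in W^* into b in
    W^perp, only the irreducibility and
    the closure of Lambda^o need work.  Parametrize Lambda by
    x in W (+) W^perp, with linear coordinates w_k and u_k, together with
    beta subject to q_k = w_k beta_k - u_k = 0.  The rank of {w_k, u_k : k in G}
    is |G| plus the connectivity function of M_W at G, so for a connected
    matroid it exceeds |G| for every proper nonempty G.  Such rank inequalities
    make a linear form a nonzerodivisor modulo the q_k, k in K: to remove q_k
    from K, one uses that q_k is itself a nonzerodivisor, because specializing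
    beta_k to a general constant turns q_k into a linear form that again
    satisfies the inequalities.  Hence, after inverting one w_i and eliminating
    beta_i, each w_k is a nonzerodivisor on Lambda, and a polynomial vanishing
    on Lambda^o vanishes on Lambda wherever some w_i is invertible, which is all
    of PW x PV^*. *)

Set Implicit Arguments.
Unset Strict Implicit.
Unset Printing Implicit Defensive.

Import GRing.Theory.
Local Open Scope ring_scope.

(** * Ideals and substitution of constants *)

Inductive ideal_gen (T : comNzRingType) (S : T -> Prop) : T -> Prop :=
| ideal_gen0 : ideal_gen S 0
| ideal_genDM a b c : S a -> ideal_gen S b -> ideal_gen S (c * a + b).

Section IdealGen.
Variables (T : comNzRingType) (S : T -> Prop).

Lemma ideal_gen_in a : S a -> ideal_gen S a.
Proof.
by move=> Sa; rewrite -[a]addr0 -[a]mul1r; apply: ideal_genDM Sa (ideal_gen0 _).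
Qed.

Lemma ideal_genD a b : ideal_gen S a -> ideal_gen S b -> ideal_gen S (a + b).
Proof.
move=> + Sb; elim=> [|x y c Sx _ IH]; first by rewrite add0r.
by rewrite -addrA; apply: ideal_genDM.
Qed.

Lemma ideal_genM c a : ideal_gen S a -> ideal_gen S (c * a).
Proof.
elim=> [|x y d Sx _ IH]; first by rewrite mulr0; apply: ideal_gen0.
by rewrite mulrDr mulrA; apply: ideal_genDM.
Qed.

Lemma ideal_genN a : ideal_gen S a -> ideal_gen S (- a).
Proof. by rewrite -mulN1r; apply: ideal_genM. Qed.

Lemma ideal_genB a b : ideal_gen S a -> ideal_gen S b -> ideal_gen S (a - b).
Proof. by move=> Sa Sb; apply: ideal_genD Sa (ideal_genN Sb). Qed.

Lemma ideal_gen_rmorph0 (A : comNzRingType) (f : {rmorphism T -> A}) g :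
  (forall a, S a -> f a = 0) -> ideal_gen S g -> f g = 0.
Proof.
move=> S0; elim=> [|a b c /S0 fa _ IH]; first by rewrite rmorph0.
by rewrite rmorphD rmorphM fa mulr0 IH addr0.
Qed.

(** Serves to split off one generator [q], a quadric or a linear form, by collecting its
    coefficients into a single [h]. *)
Lemma ideal_gen_adjoin (S' : T -> Prop) q g :
    (forall a, S' a -> exists h, ideal_gen S (a - h * q)) ->
  ideal_gen S' g -> exists h, ideal_gen S (g - h * q).
Proof.
move=> S'P; elim=> [|a b c /S'P[h Ih] _ [k Ik]].
  by exists 0; rewrite mul0r subr0; apply: ideal_gen0.
exists (c * h + k).
rewrite (_ : _ - _ = c * (a - h * q) + (b - k * q)); last by ring.
exact: ideal_genD (ideal_genM _ Ih) Ik.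
Qed.

End IdealGen.

Lemma ideal_gen_rmorph (T T' : comNzRingType) (S : T -> Prop) (S' : T' -> Prop)
    (f : {rmorphism T -> T'}) g :
  (forall a, S a -> ideal_gen S' (f a)) -> ideal_gen S g -> ideal_gen S' (f g).
Proof.
move=> SS'; elim=> [|a b c Sa _ IH]; first by rewrite rmorph0; apply: ideal_gen0.
by rewrite rmorphD rmorphM; apply: ideal_genD IH; apply/ideal_genM/SS'.
Qed.

Lemma ideal_genS (T : comNzRingType) (S S' : T -> Prop) g :
  (forall a, S a -> ideal_gen S' a) -> ideal_gen S g -> ideal_gen S' g.
Proof. exact: (ideal_gen_rmorph (f := idfun)). Qed.

Lemma mpoly_ring_ind (F : comNzRingType) N (P : {mpoly F[N]} -> Prop) :
    (forall c, P c%:MP) -> (forall i, P 'X_i) ->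
    (forall f g, P f -> P g -> P (f + g)) ->
    (forall f g, P f -> P g -> P (f * g)) ->
  forall f, P f.
Proof.
move=> PC PX PD PM; elim/mpolyind => [|c m f _ _ IH].
  by rewrite -[0]/(0%:MP).
apply: (PD) IH; rewrite -mul_mpolyC; apply: (PM) => //.
rewrite mpolyXE_id; elim/big_ind: _ => // [|i _]; first by rewrite -[1]/(1%:MP).
by elim: (m i) => [|k IH]; [rewrite expr0 -[1]/(1%:MP) | rewrite exprS; apply: PM].
Qed.

Lemma rmorph_mpoly_eq (F R : comNzRingType) N
    (f g : {rmorphism {mpoly F[N]} -> R}) :
  (forall c, f c%:MP = g c%:MP) -> (forall i, f 'X_i = g 'X_i) -> f =1 g.
Proof.
move=> eqC eqX; elim/mpoly_ring_ind => // p q Ip Iq.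
  by rewrite !rmorphD Ip Iq.
by rewrite !rmorphM Ip Iq.
Qed.

Lemma mmapXi (F R : comNzRingType) N (f : {rmorphism F -> R}) (h : 'I_N -> R) i :
  mmap f h 'X_i = h i.
Proof. by rewrite mmapX mmap1U. Qed.

Section Substitution.
Variables (F : fieldType) (N : nat).
Hypothesis infF : forall s : seq F, exists c, c \notin s.
Local Notation T := {mpoly F[N]}.

Definition subst_var (i : 'I_N) (c : F) : T -> T :=
  mmap (@mpolyC N F) (fun j => if j == i then c%:MP else 'X_j).
HB.instance Definition _ i c := GRing.RMorphism.on (subst_var i c).

(** The coefficients stay in [T], although free of ['X_i], so that evaluation at a constant and at
    ['X_i] itself both land in [T]. *)
Definition poly_in_var (i : 'I_N) : T -> {poly T} :=
  mmap (polyC \o @mpolyC N F) (fun j => if j == i then 'X else ('X_j)%:P).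
HB.instance Definition _ i := GRing.RMorphism.on (poly_in_var i).

Lemma subst_varE i c j :
  subst_var i c 'X_j = if j == i then c%:MP else 'X_j.
Proof. exact: mmapXi. Qed.

Lemma horner_poly_in_var i c g : (poly_in_var i g).[c%:MP] = subst_var i c g.
Proof.
pose f := horner_eval (c%:MP : T) \o poly_in_var i.
rewrite -[LHS]/(f g); apply: (@rmorph_mpoly_eq _ _ _ f (subst_var i c)) => [d|j].
  by rewrite /f /= /horner_eval /poly_in_var /subst_var !mmapC hornerC.
rewrite /f /= /horner_eval /poly_in_var mmapXi subst_varE.
by case: eqP; rewrite (hornerX, hornerC).
Qed.

Lemma poly_in_varK i g : (poly_in_var i g).['X_i] = g.
Proof.
pose f := horner_eval ('X_i : T) \o poly_in_var i.
rewrite -[LHS]/(f g); apply: (@rmorph_mpoly_eq _ _ _ f idfun) => [d|j].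
  by rewrite /f /= /horner_eval /poly_in_var mmapC hornerC.
rewrite /f /= /horner_eval /poly_in_var mmapXi.
by case: eqP => [->|]; rewrite (hornerX, hornerC).
Qed.

(** Divided differences, by induction on the degree: write [G = (X - c) H + G(c)] with [c] outside
    [bad], which exists as [F] is infinite. The values of [H] at constants are quotients of
    differences of values of [G]. *)
Lemma ideal_gen_interpolation (S : T -> Prop) (G : {poly T}) (bad : seq F) x :
  (forall c, c \notin bad -> ideal_gen S G.[c%:MP]) -> ideal_gen S G.[x].
Proof.
elim: {G}(size G) {-2}G (leqnn (size G)) bad => [|m IH] G.
  rewrite leqn0 size_poly_eq0 => /eqP-> bad _.
  by rewrite horner0; apply: ideal_gen0.
move=> sG bad IG; have [c c_bad] := infF bad.
have /factor_theorem[H defG] : root (G - (G.[c%:MP])%:P) (c%:MP).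
  by rewrite rootE !hornerE subrr.
have eqG y : G.[y] = (y - c%:MP) * H.[y] + G.[c%:MP].
  by rewrite -[G in LHS](subrK (G.[c%:MP])%:P) defG !hornerE mulrC.
rewrite eqG; apply: ideal_genD (IG _ c_bad); apply: ideal_genM.
(* [c] joins the bad constants because the divided difference divides by [d - c]. *)
apply: (IH _ _ (c :: bad)) => [|d].
  have [->|nzH] := eqVneq H 0; first by rewrite size_poly0.
  have := size_Mmonic nzH (monicXsubC (c%:MP : T)).
  rewrite size_XsubC addn2 /= -defG -ltnS => <-.
  rewrite (leq_trans (size_polyD _ _)) // geq_max sG size_polyN.
  exact: leq_trans (size_polyC_leq1 _) _.
rewrite inE negb_or => /andP[d_c d_bad].
have -> : H.[d%:MP] = (d - c)^-1%:MP * (G.[d%:MP] - G.[c%:MP]).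
  rewrite eqG addrK -mpolyCB mulrA -mpolyCM mulVf ?mul1r //.
  by rewrite subr_eq0.
by apply: ideal_genM; apply: ideal_genB; apply: IG.
Qed.

Lemma mpoly_vanish_eq0 (g : T) : (forall y : 'I_N -> F, g.@[y] = 0) -> g = 0.
Proof.
pose subst (s : seq 'I_N) (y : 'I_N -> F) : {mpoly F[N]} -> T :=
  mmap (@mpolyC N F) (fun j => if j \in s then (y j)%:MP else 'X_j).
(* Constants replace one variable at a time, so the claim is generalized to a list [s] of
   variables. *)
suff vanish s : uniq s -> forall p, (forall y, subst s y p = 0) -> p = 0.
  move=> g0; apply: (vanish (enum 'I_N)) => [|y]; first exact: enum_uniq.
  rewrite -(mpolyC0 _ F) -(g0 y).
  pose f1 : {rmorphism T -> T} := mmap (@mpolyC N F)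
     (fun j => if j \in enum 'I_N then (y j)%:MP else 'X_j).
  pose f2 : {rmorphism T -> T} := (@mpolyC N F) \o (meval y).
  apply: (@rmorph_mpoly_eq _ _ _ f1 f2) => [c|j].
    by rewrite /f1 /f2 /= mmapC mevalC.
  by rewrite /f1 /f2 /= mmapXi mevalXU mem_enum.
elim: s => [|i s IH] /= => [_ p /(_ (fun=> 0)) <-|/andP[i_s uniq_s] p p0].
  rewrite -[LHS]/(idfun p) /subst; apply: rmorph_mpoly_eq => [c|j].
    by rewrite /= mmapC.
  by rewrite /= mmapXi.
have subst0 c : subst_var i c p = 0.
  apply: (IH uniq_s) => y; pose y' j := if j == i then c else y j.
  rewrite -(p0 y') -[LHS]/((subst s y \o subst_var i c) p) /subst.
  apply: rmorph_mpoly_eq => [d|j]; rewrite /= /subst_var.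
    by rewrite !mmapC.
  rewrite !mmapXi in_cons /y'; case: eqP => [->|_]; rewrite (mmapC,mmapXi) //.
(* The ideal generated by no elements is zero, so interpolation applies to vanishing itself. *)
have : ideal_gen (fun _ : T => False) p.
  rewrite -(poly_in_varK i p); apply: (ideal_gen_interpolation (bad := [::])).
  by move=> c _; rewrite horner_poly_in_var subst0; apply: ideal_gen0.
exact: (ideal_gen_rmorph0 (f := idfun)).
Qed.

End Substitution.

(** * Regular sequences of linear forms and quadrics *)

Section Forms.
Variables (F : fieldType) (m n : nat).
Hypothesis infF : forall s : seq F, exists c, c \notin s.
Variables (w u : 'I_n -> 'rV[F]_m).
Local Notation T := {mpoly F[m + n]}.

(** The first [m] variables of [T] are coordinates on a parameter space, the last [n] are the
    beta_k. *)
Definition lin (a : 'rV[F]_m) : T := \sum_j a 0 j *: 'X_(lshift n j).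

Lemma lin_is_linear : linear lin.
Proof.
move=> c a b; rewrite /lin scaler_sumr -big_split; apply: eq_bigr => j _ /=.
by rewrite !mxE scalerDl scalerA.
Qed.
HB.instance Definition _ :=
  GRing.isLinear.Build F 'rV[F]_m T _ lin lin_is_linear.

Lemma lin_eq0 a : (lin a == 0) = (a == 0).
Proof.
apply/eqP/eqP => [lin0|->]; last exact: linear0.
apply/rowP => j; rewrite mxE.
have := congr1 (fun p : T => p@_U_(lshift n j)) lin0.
rewrite mcoeff0 /lin raddf_sum (bigD1 j) //= mcoeffZ mcoeffXU eqxx mulr1.
rewrite big1 ?addr0 // => i /negPf ij.
by rewrite mcoeffZ mcoeffXU eq_lshift ij mulr0.
Qed.

Lemma lin_delta j : lin (delta_mx 0 j) = 'X_(lshift n j).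
Proof.
rewrite /lin (bigD1 j) //= mxE !eqxx scale1r big1 ?addr0 // => i /negPf ij.
by rewrite mxE ij andbF scale0r.
Qed.

Lemma rmorph_lin (R : comNzRingType) (f : {rmorphism T -> R}) a :
  f (lin a) = \sum_j f (a 0 j)%:MP * f 'X_(lshift n j).
Proof.
by rewrite rmorph_sum; apply: eq_bigr => j _; rewrite -mul_mpolyC rmorphM.
Qed.

Definition beta k : T := 'X_(rshift m k).
Definition quad k : T := lin (w k) * beta k - lin (u k).

Definition eqs (U : {vspace 'rV[F]_m}) (K : {set 'I_n}) (p : T) : Prop :=
  (exists2 a, a \in U & p = lin a) \/ (exists2 k, k \in K & p = quad k).

Local Notation ideal U K := (ideal_gen (eqs U K)).

Definition form_span (G : {set 'I_n}) : {vspace 'rV[F]_m} :=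
  (\sum_(k in G) (<[w k]> + <[u k]>))%VS.

(** The inequalities of Rado's theorem modulo [U]: they say that for general constants c_k the forms
    c_k w_k - u_k, k in [K], are linearly independent modulo [U]. *)
Definition independent (U : {vspace 'rV[F]_m}) (K : {set 'I_n}) : Prop :=
  forall G : {set 'I_n}, G \subset K -> (\dim U + #|G| <= \dim (U + form_span G))%N.

Lemma independentS U (K K' : {set 'I_n}) :
  K' \subset K -> independent U K -> independent U K'.
Proof. by move=> sK IK G sG; apply: IK; apply: subset_trans sK. Qed.

Lemma ideal_eqsS U (K K' : {set 'I_n}) g :
  K \subset K' -> ideal U K g -> ideal U K' g.
Proof.
move=> sK; apply: ideal_genS => a [Ua|[k Kk ->]]; apply: ideal_gen_in.
  by left.
by right; exists k => //; apply: subsetP sK _ Kk.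
Qed.

Lemma ideal_eqs_adjoin_quad U (K : {set 'I_n}) k g :
  ideal U (k |: K) g -> exists h, ideal U K (g - h * quad k).
Proof.
apply: ideal_gen_adjoin => a [Ua|[l]].
  by exists 0; rewrite mul0r subr0; apply: ideal_gen_in; left.
rewrite in_setU1 => /predU1P[-> ->|Kl ->].
  by exists 1; rewrite mul1r subrr; apply: ideal_gen0.
exists 0; rewrite mul0r subr0; apply: ideal_gen_in; right.
by exists l.
Qed.

Lemma ideal_eqs_adjoin_lin U K v g :
  ideal (U + <[v]>) K g -> exists h, ideal U K (g - h * lin v).
Proof.
apply: ideal_gen_adjoin => a [[b /memv_addP[x Ux [y /vlineP[c ->] ->]] ->]|Ka].
  exists c%:MP; rewrite mul_mpolyC linearD linearZ addrK.
  by apply: ideal_gen_in; left; exists x.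
by exists 0; rewrite mul0r subr0; apply: ideal_gen_in; right.
Qed.

(** Substitutes for each linear coordinate its component along a complement of [U]; this models the
    quotient by the linear forms in [U] inside [T] itself. *)
Definition proj_var (U : {vspace 'rV[F]_m}) (i : 'I_(m + n)) : T :=
  match split i with
  | inl j => lin (delta_mx 0 j - projv U (delta_mx 0 j))
  | inr k => beta k
  end.

Lemma ideal_proj U g :
  ideal U set0 (g - mmap (@mpolyC (m + n) F) (proj_var U) g).
Proof.
elim/mpoly_ring_ind: g => [c|i|f g If Ig|f g If Ig].
- by rewrite mmapC subrr; apply: ideal_gen0.
- rewrite mmapXi /proj_var; case: split_ordP => j -> /=.
    apply: ideal_gen_in; left; exists (projv U (delta_mx 0 j)).
      exact: memv_proj.
    by rewrite linearB /= lin_delta subKr.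
  by rewrite subrr; apply: ideal_gen0.
- by rewrite mmapD opprD addrACA; apply: ideal_genD.
rewrite rmorphM /=; set f' := mmap _ _ f in If *; set g' := mmap _ _ g in Ig *.
have -> : f * g - f' * g' = g * (f - f') + f' * (g - g') by ring.
by apply: ideal_genD; apply: ideal_genM.
Qed.

Lemma proj_lin U a :
  mmap (@mpolyC (m + n) F) (proj_var U) (lin a) = lin (a - projv U a).
Proof.
rewrite rmorph_lin [in RHS](row_sum_delta a) linear_sum -sumrB linear_sum.
apply: eq_bigr => j _ /=; rewrite mmapC mmapXi /proj_var.
case: split_ordP => [i /lshift_inj <-|i /eqP]; last by rewrite eq_lrshift.
by rewrite [in RHS]linearZ -scalerBr linearZ mul_mpolyC.
Qed.

(** The substitution [proj_var U] kills the ideal but not [lin v], and [T] is a domain. *)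
Lemma lin_regular0 (U : {vspace 'rV[F]_m}) v g :
  v \notin U -> ideal U set0 (lin v * g) -> ideal U set0 g.
Proof.
move=> vU Ig; rewrite -[g](subrK (mmap (@mpolyC (m + n) F) (proj_var U) g)).
apply: ideal_genD; first exact: ideal_proj.
suff -> : mmap (@mpolyC (m + n) F) (proj_var U) g = 0 by apply: ideal_gen0.
have /eqP : mmap (@mpolyC (m + n) F) (proj_var U) (lin v * g) = 0.
  apply: ideal_gen_rmorph0 Ig => p [[a Ua ->]|[k]]; last by rewrite in_set0.
  by rewrite /= proj_lin projv_id // subrr linear0.
rewrite rmorphM /= proj_lin mulf_eq0 lin_eq0 => /orP[|/eqP//].
rewrite subr_eq0 => /eqP def_v; case/negP: vU.
by rewrite def_v memv_proj.
Qed.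

Lemma subst_var_lin k c a : subst_var (rshift m k) c (lin a) = lin a.
Proof.
rewrite rmorph_lin; apply: eq_bigr => j _ /=.
by rewrite subst_varE eq_lrshift /subst_var mmapC mul_mpolyC.
Qed.

Lemma subst_var_quad k l c : subst_var (rshift m k) c (quad l) =
  if l == k then lin (c *: w k - u k) else quad l.
Proof.
rewrite rmorphB rmorphM /= !subst_var_lin subst_varE eq_rshift.
by case: eqP => [->|//]; rewrite linearB linearZ mulrC mul_mpolyC.
Qed.

Lemma notin_dim_addv (U : {vspace 'rV[F]_m}) v :
  v \notin U -> (\dim U < \dim (U + <[v]>))%N.
Proof.
move=> vU; rewrite (ltn_leqif (dimv_leqif_sup (addvSl _ _))).
by apply: contra vU => /subvP-> //; rewrite memvE addvSr.
Qed.

Lemma dim_addv_line (U : {vspace 'rV[F]_m}) v :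
  (\dim (U + <[v]>) <= (\dim U).+1)%N.
Proof.
apply: leq_trans (dimv_add_leqif _ _) _; rewrite dim_vline.
by case: (v != 0); rewrite (addn0, addn1).
Qed.

Lemma form_span1 k (G : {set 'I_n}) : k \notin G ->
  form_span (k |: G) = (<[w k]> + <[u k]> + form_span G)%VS.
Proof. by move=> kG; rewrite /form_span big_setU1. Qed.

(** If [a] is not in [Y], then [c a = b] modulo [Y] has at most one solution [c]; if only [b] is
    outside [Y], it has none. *)
Lemma generic_notin (Y : {vspace 'rV[F]_m}) a b :
    ~~ ((a \in Y) && (b \in Y)) ->
  exists c0, forall c, c != c0 -> c *: a - b \notin Y.
Proof.
case: (boolP (a \in Y)) => [aY bY|aY _].
  exists 0 => c _; apply: contra bY => cab.
  by rewrite -[b](subKr (c *: a)) memvB // memvZ.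
have [/memv_addP[y Yy [z /vlineP[c0 ->] ->]]|bY] := boolP (b \in Y + <[a]>)%VS.
  exists c0 => c cc0; rewrite opprD addrCA -scalerBl.
  rewrite rpredDl ?rpredN //; apply: contra aY => yca.
  by rewrite -[a](scalerK (_ : c - c0 != 0)) ?subr_eq0 // memvZ.
exists 0 => c _; apply: contra bY => cab; rewrite -[b](subKr (c *: a)).
rewrite addrC; apply: memv_add; first by rewrite memvN.
by rewrite memvZ // memv_line.
Qed.

(** Each [G] inside [K] excludes at most one constant. Put [Y = U + form_span G]: if [Y] contains
    w_k and u_k, the inequality for [k |: G] already gives one spare dimension; otherwise a general
    [c w_k - u_k] lies outside [Y] and adds one. This extra dimension pays for enlarging [U]. *)
Lemma independent_generic (U : {vspace 'rV[F]_m}) (K : {set 'I_n}) k :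
    k \notin K -> independent U (k |: K) ->
  exists bad : seq F, forall c, c \notin bad ->
    c *: w k - u k \notin U /\ independent (U + <[c *: w k - u k]>) K.
Proof.
move=> kK IU.
have /fin_all_exists[b bP] (G : {set 'I_n}) : exists b, forall c, c != b ->
    G \subset K -> (\dim U + #|G| <
      \dim (U + form_span G + <[c *: w k - u k]>))%N.
  have [sGK|_] := boolP (G \subset K); last by exists 0.
  have := IU _ (setUS [set k] sGK).
  have := IU _ (subset_trans sGK (subsetUr [set k] _)).
  have kG : k \notin G by apply: contra kK; apply: subsetP sGK _.
  rewrite form_span1 // cardsU1 kG; set Y := (U + form_span G)%VS => leY ltY.
  have [/andP[wY uY]|/generic_notin[c0 c0P]] := boolP ((w k \in Y) && (u k \in Y)).
    exists 0 => c _ _; apply: leq_trans (dimvS (addvSl _ _)).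
    rewrite -addnS; apply: leq_trans ltY _; apply: dimvS.
    by rewrite !subv_add addvSl addvSr -!memvE wY uY.
  exists c0 => c /c0P cY _; exact: leq_ltn_trans leY (notin_dim_addv cY).
exists (codom b) => c c_bad.
have {}bP (G : {set 'I_n}) : G \subset K -> (\dim U + #|G| <
    \dim (U + form_span G + <[c *: w k - u k]>))%N.
  by apply: bP; apply: contra c_bad => /eqP->; apply: codom_f.
split.
  (* The empty [G] says that the new form is not in [U]. *)
  have := bP set0 (sub0set _); rewrite /form_span big_set0 addv0 cards0 addn0.
  by apply: contraL => ?; rewrite (addv_idPl _) ?ltnn // -memvE.
move=> G /bP; rewrite -addvA (addvC (form_span G)) addvA.
by apply: leq_trans; rewrite -addSn leq_add2r; apply: dim_addv_line.
Qed.

Section Step.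
Variable K : {set 'I_n}.
Hypothesis lin_regularK : forall (U : {vspace 'rV[F]_m}) v g, v \notin U ->
  independent (U + <[v]>) K -> ideal U K (lin v * g) -> ideal U K g.

(** Replacing beta_k by a constant [c] fixes the other generators, since [k] is not in [K], and
    sends [quad k] to a linear form that is regular for all but finitely many [c]; interpolation
    then recovers [g]. The section hypothesis is the induction hypothesis of [lin_regular]. *)
Lemma quad_regular_step (U : {vspace 'rV[F]_m}) k g :
    k \notin K -> independent U (k |: K) ->
  ideal U K (quad k * g) -> ideal U K g.
Proof.
move=> kK IU Ig; have [bad badP] := independent_generic kK IU.
rewrite -(poly_in_varK (rshift m k) g).
apply: (ideal_gen_interpolation infF (bad := bad)) => c /badP[cU cI].
rewrite horner_poly_in_var; apply: lin_regularK cU cI _.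
have := subst_var_quad k k c; rewrite eqxx => <-; rewrite -rmorphM /=.
apply: ideal_gen_rmorph Ig => p [[a Ua ->]|[l Kl ->]]; apply: ideal_gen_in.
  by left; exists a; rewrite //= subst_var_lin.
right; exists l; rewrite //= subst_var_quad; case: eqP => // lk.
by rewrite -lk Kl in kK.
Qed.

End Step.

(** Induction on the size of [K], by exchanging two elements of a regular sequence. Modulo
    [ideal U K'] one has [lin v * g = h * quad k]; regularity of [quad k] modulo [U + <[v]>] makes
    [h] a multiple [h' * lin v], and cancelling [lin v] leaves [g = h' * quad k]. *)
Lemma lin_regular K (U : {vspace 'rV[F]_m}) v g :
  v \notin U -> independent (U + <[v]>) K ->
  ideal U K (lin v * g) -> ideal U K g.
Proof.
elim: {K}#|K| {-2}K (erefl #|K|) U v g => [|s IH] K cK U v g vU IU.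
  by have /eqP := cK; rewrite cards_eq0 => /eqP->; apply: lin_regular0.
have /card_gt0P[k Kk] : (0 < #|K|)%N by rewrite cK.
rewrite -(setD1K Kk); set K' := K :\ k.
have cK' : #|K'| = s by have := cardsD1 k K; rewrite Kk cK => -[].
have kK' : k \notin K' by rewrite in_setD1 eqxx.
move=> /ideal_eqs_adjoin_quad[h Ih].
have sK' : K' \subset k |: K' by apply: subsetUr.
have /ideal_eqs_adjoin_lin[h' Ih'] : ideal (U + <[v]>) K' h.
  apply: quad_regular_step (IH _ cK') _ _ _ kK' _ _; first by rewrite setD1K.
  have -> : quad k * h = lin v * g - (lin v * g - h * quad k) by ring.
  apply: ideal_genB.
    rewrite mulrC; apply/ideal_genM/ideal_gen_in; left; exists v => //.
    by rewrite memvE addvSr.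
  apply: ideal_genS Ih => a [[b Ub ->]|Ka]; apply: ideal_gen_in; last by right.
  by left; exists b => //; apply: subvP (addvSl _ _) _ Ub.
have IK' : independent (U + <[v]>) K' by apply: independentS IU; apply: subD1set.
rewrite -[g](subrK (h' * quad k)); apply: ideal_genD; last first.
  apply/ideal_genM/ideal_gen_in; right; exists k => //; exact: setU11.
apply: ideal_eqsS sK' _; apply: (IH _ cK' _ _ _ vU IK').
have -> : lin v * (g - h' * quad k) =
  lin v * g - h * quad k + quad k * (h - h' * lin v) by ring.
by apply: ideal_genD => //; apply: ideal_genM.
Qed.

(** * Polynomials vanishing on the graph beta = u / w *)

Definition pt (x : 'rV[F]_m) (b : 'rV[F]_n) (i : 'I_(m + n)) : F :=
  row_mx x b 0 i.
Definition dot (a x : 'rV[F]_m) : F := \sum_j a 0 j * x 0 j.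

Lemma meval_lin a x b : (lin a).@[pt x b] = dot a x.
Proof.
rewrite (rmorph_lin (meval (pt x b))); apply: eq_bigr => j _ /=.
by rewrite mevalC mevalXU /pt row_mxEl.
Qed.

Definition wprod (K : {set 'I_n}) : T := \prod_(k in K) lin (w k).

(** Not involving beta_k is expressed through values, which determine a polynomial over the infinite
    field [F]. *)
Definition free_of (K : {set 'I_n}) (h : T) := forall x (b b' : 'rV[F]_n),
  (forall k, k \notin K -> b 0 k = b' 0 k) -> h.@[pt x b] = h.@[pt x b'].

Lemma free_ofD K h h' : free_of K h -> free_of K h' -> free_of K (h + h').
Proof. by move=> fh fh' x b b' bb'; rewrite !mevalD (fh x b b') // (fh' x b b'). Qed.

Lemma free_ofM K h h' : free_of K h -> free_of K h' -> free_of K (h * h').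
Proof. by move=> fh fh' x b b' bb'; rewrite !mevalM (fh x b b') // (fh' x b b'). Qed.

Lemma free_of_lin K a : free_of K (lin a).
Proof. by move=> x b b' _; rewrite !meval_lin. Qed.

Lemma free_of_wprod K K' M : free_of K (wprod K' ^+ M).
Proof.
move=> x b b' _; rewrite !rmorphXn !rmorph_prod /=; congr (_ ^+ _).
by apply: eq_bigr => k _; rewrite !meval_lin.
Qed.

Local Notation ideal0 K := (ideal_gen (eqs 0%VS K)).

(** Modulo the quadrics beta_k is u_k / w_k; the power of [wprod K] clears the denominators. *)
Lemma eliminate_beta K g :
  exists M h, free_of K h /\ ideal0 K (wprod K ^+ M * g - h).
Proof.
elim/mpoly_ring_ind: g => [c|i|f g [M [h [fh Ih]]] [M' [h' [fh' Ih']]]|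
    f g [M [h [fh Ih]]] [M' [h' [fh' Ih']]]].
- exists 0, c%:MP; split; first by move=> x b b' _; rewrite !mevalC.
  by rewrite mul1r subrr; apply: ideal_gen0.
- case: (split_ordP i) => [j ->|k ->].
    exists 0, 'X_(lshift n j); rewrite mul1r subrr; split; last exact: ideal_gen0.
    by move=> x b b' _; rewrite !mevalXU /pt !row_mxEl.
  have [Kk|K'k] := boolP (k \in K); last first.
    exists 0, (beta k); rewrite mul1r subrr; split; last exact: ideal_gen0.
    by move=> x b b' bb'; rewrite !mevalXU /pt !row_mxEr bb'.
  (* The factor w_k of [wprod K] turns beta_k into u_k; the other factors remain. *)
  exists 1, (wprod (K :\ k) ^+ 1 * lin (u k)); split.
    by apply: free_ofM; [exact: free_of_wprod|exact: free_of_lin].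
  rewrite !expr1 {1}/wprod (big_setD1 k) //= -/(wprod _) -/(beta k).
  rewrite (_ : _ - _ = wprod (K :\ k) * quad k); last by rewrite /quad; ring.
  by apply/ideal_genM/ideal_gen_in; right; exists k.
- exists (M + M'), (wprod K ^+ M' * h + wprod K ^+ M * h'); split.
    by apply: free_ofD; apply: free_ofM => //; apply: free_of_wprod.
  rewrite exprD (_ : _ - _ = wprod K ^+ M' * (wprod K ^+ M * f - h)
    + wprod K ^+ M * (wprod K ^+ M' * g - h')); last by ring.
  by apply: ideal_genD; apply: ideal_genM.
exists (M + M'), (h * h'); split; first exact: free_ofM.
rewrite exprD (_ : _ - _ = wprod K ^+ M' * g * (wprod K ^+ M * f - h)
  + h * (wprod K ^+ M' * g - h')); last by ring.
by apply: ideal_genD; apply: ideal_genM.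
Qed.

(** Nonvanishing of the u_k as well makes u_k / w_k nonzero, so that the graph lies over both
    tori. *)
Definition generic (x : 'rV[F]_m) := forall k, dot (w k) x != 0 /\ dot (u k) x != 0.

Definition on_graph (K : {set 'I_n}) x (b : 'rV[F]_n) :=
  forall k, k \in K -> b 0 k = dot (u k) x / dot (w k) x.

Definition vanish_on_graph K g :=
  forall x b, generic x -> on_graph K x b -> g.@[pt x b] = 0.

Hypotheses (w_neq0 : forall k, w k != 0) (u_neq0 : forall k, u k != 0).

(** Multiplying [h] by all the forms w_k and u_k gives a polynomial that vanishes at every point,
    and these forms are nonzero in a domain. *)
Lemma generic_vanish_eq0 h :
  (forall x b, generic x -> h.@[pt x b] = 0) -> h = 0.
Proof.
move=> h0; pose P := \prod_k (lin (w k) * lin (u k)).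
have P0 : P != 0.
  by apply/prodf_neq0 => k _; rewrite mulf_neq0 ?lin_eq0.
have /eqP : h * P = 0.
  apply: (mpoly_vanish_eq0 infF) => y.
  pose x := \row_j y (lshift n j); pose b := \row_k y (rshift m k).
  have ypt : y =1 pt x b.
    by move=> i; rewrite /pt; case: (split_ordP i) => k ->;
      rewrite ?row_mxEl ?row_mxEr mxE.
  rewrite (meval_eq _ ypt) mevalM.
  have [->|] := eqVneq P.@[pt x b] 0; first by rewrite mulr0.
  rewrite rmorph_prod => /prodf_neq0 genx; rewrite h0 ?mul0r // => k.
  by have := genx k isT; rewrite /= mevalM !meval_lin mulf_eq0 negb_or => /andP.
by rewrite mulf_eq0 (negPf P0) orbF => /eqP.
Qed.

Lemma meval_ideal_on_graph K x b g :
  generic x -> on_graph K x b -> ideal0 K g -> g.@[pt x b] = 0.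
Proof.
move=> gx gb; apply: (ideal_gen_rmorph0 (f := meval (pt x b))) => p.
case=> [[a + ->]|[k Kk ->]]; first by rewrite memv0 => /eqP->; rewrite linear0 rmorph0.
rewrite /quad /= mevalB mevalM !meval_lin mevalXU /pt row_mxEr gb //.
by rewrite mulrC divfK ?subrr //; case: (gx k).
Qed.

Lemma exists_on_graph (K : {set 'I_n}) x (b : 'rV[F]_n) :
  exists2 b', on_graph K x b' &
  forall k, k \notin K -> b 0 k = b' 0 k.
Proof.
exists (\row_k if k \in K then dot (u k) x / dot (w k) x else b 0 k) => k kK.
  by rewrite mxE kK.
by rewrite mxE (negPf kK).
Qed.

Lemma meval_wprod_neq0 K M x b : generic x -> (wprod K ^+ M).@[pt x b] != 0.
Proof.
move=> gx; rewrite rmorphXn rmorph_prod expf_neq0 //; apply/prodf_neq0 => k _.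
by rewrite /= meval_lin; case: (gx k).
Qed.

(** After elimination the remainder [h] ignores the beta_k with k in [K], so any point over a
    generic [x] can be moved onto the graph without changing its value; hence [h = 0]. *)
Lemma vanish_on_graph_ideal K g :
  vanish_on_graph K g -> exists M, ideal0 K (wprod K ^+ M * g).
Proof.
move=> g0; have [M [h [fh Ih]]] := eliminate_beta K g.
suff h0 : h = 0 by exists M; rewrite -[_ * g]subr0 -h0.
apply: generic_vanish_eq0 => x b gx.
have [b' gb' bb'] := exists_on_graph K x b.
rewrite (fh x b b' bb'); have := meval_ideal_on_graph gx gb' Ih.
by rewrite mevalB mevalM (g0 x b') // mulr0 sub0r => /eqP; rewrite oppr_eq0 => /eqP.
Qed.

(** Elimination replaces [f] and [g] by [h] and [h'], whose product vanishes at all generic points;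
    the polynomial ring is a domain. *)
Lemma vanish_on_graph_prime K f g : vanish_on_graph K (f * g) ->
  vanish_on_graph K f \/ vanish_on_graph K g.
Proof.
move=> fg0.
have [M [h [fh Ih]]] := eliminate_beta K f.
have [M' [h' [fh' Ih']]] := eliminate_beta K g.
have vanish_of0 N p : ideal0 K (wprod K ^+ N * p - 0) -> vanish_on_graph K p.
  rewrite subr0 => Ip x b gx gb; have /eqP := meval_ideal_on_graph gx gb Ip.
  by rewrite mevalM mulf_eq0 (negPf (meval_wprod_neq0 _ _ _ gx)) => /eqP.
have /eqP : h * h' = 0.
  apply: generic_vanish_eq0 => x b gx.
  have [b' gb' bb'] := exists_on_graph K x b.
  have /eqP := meval_ideal_on_graph gx gb' Ih.
  have /eqP := meval_ideal_on_graph gx gb' Ih'.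
  rewrite mevalM (fh x b b' bb') (fh' x b b' bb').
  rewrite !mevalB !mevalM !subr_eq0 => /eqP<- /eqP<-.
  by rewrite mulrACA -[f.@[_] * _]mevalM (fg0 x b') // mulr0.
rewrite mulf_eq0 => /orP[] /eqP eq0.
  by left; apply: (vanish_of0 M); rewrite -eq0.
by right; apply: (vanish_of0 M'); rewrite -eq0.
Qed.

(** * Evaluation at graph points with values in an algebra *)

Section AlgebraPoint.
Variables (A : comUnitAlgType F) (x : 'rV[A]_m) (b : 'rV[A]_n).

Definition alg_eval : T -> A :=
  mmap (GRing.in_alg A : {rmorphism F -> A}) (fun i => row_mx x b 0 i).
HB.instance Definition _ := GRing.RMorphism.on alg_eval.

Lemma alg_evalC c : alg_eval c%:MP = c%:A.
Proof. exact: (mmapC _ (GRing.in_alg A : {rmorphism F -> A})). Qed.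

Lemma alg_evalX i : alg_eval 'X_i = row_mx x b 0 i.
Proof. exact: (mmapXi (GRing.in_alg A : {rmorphism F -> A})). Qed.

Lemma alg_eval_lin a : alg_eval (lin a) = \sum_j a 0 j *: x 0 j.
Proof.
rewrite rmorph_lin; apply: eq_bigr => j _ /=.
by rewrite alg_evalC alg_evalX row_mxEl -scalerAl mul1r.
Qed.

Hypothesis graph_eq :
  forall k, alg_eval (lin (w k)) * b 0 k = alg_eval (lin (u k)).

Lemma alg_eval_ideal K g : ideal0 K g -> alg_eval g = 0.
Proof.
apply: ideal_gen_rmorph0 => p [[a + ->]|[k _ ->]].
  by rewrite memv0 => /eqP->; rewrite linear0 rmorph0.
by rewrite /quad rmorphB rmorphM /= alg_evalX row_mxEr graph_eq subrr.
Qed.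

Lemma alg_eval_torus g : (forall k, alg_eval (lin (w k)) \is a GRing.unit) ->
  vanish_on_graph setT g -> alg_eval g = 0.
Proof.
move=> wU /vanish_on_graph_ideal[M /alg_eval_ideal]; rewrite rmorphM.
have wpU : alg_eval (wprod setT ^+ M) \is a GRing.unit.
  rewrite rmorphXn rmorph_prod unitrX //.
  by apply: (big_ind (fun y : A => y \is a GRing.unit)) => // [|y z yU zU];
    rewrite ?unitr1 ?unitrM ?yU.
by move=> /(congr1 (fun y => (alg_eval (wprod setT ^+ M))^-1 * y));
  rewrite /= mulKr // mulr0.
Qed.

Hypothesis rank_gt : forall G : {set 'I_n}, G != set0 -> ~: G != set0 ->
  (#|G| < \dim (form_span G))%N.

(** Only beta_i is eliminated, at the cost of a power of w_i. The remainder [h] lies in the ideal of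
    the other quadrics up to a power of [wprod K], and the factors of [wprod K] are regular modulo
    that ideal. *)
Lemma vanish_on_graph_nilpotent i g : vanish_on_graph setT g ->
  exists N, alg_eval (lin (w i)) ^+ N * alg_eval g = 0.
Proof.
(* Omitting [i] makes every subset of [K] proper, as [rank_gt] requires. *)
move=> g0; pose K := ~: [set i].
have [N [h [fh Ih]]] := eliminate_beta [set i] g.
suff Kh : ideal0 K h.
  exists N; have := alg_eval_ideal Ih; rewrite rmorphB rmorphM rmorphXn /=.
  by rewrite /wprod big_set1 (alg_eval_ideal Kh) subr0.
have [M] : exists M, ideal0 K (wprod K ^+ M * h).
  (* As [h] ignores beta_i, that coordinate may be moved so that the whole point lies on the graph
     for [setT], where [g] vanishes. *)
  apply: vanish_on_graph_ideal => x' b' gx gb.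
  have [b'' gb'' bb''] := exists_on_graph [set i] x' b'.
  rewrite (fh _ _ _ bb''); have := meval_ideal_on_graph gx gb'' Ih.
  rewrite mevalB mevalM (g0 x' b'') // ?mulr0 => [|k _].
    by rewrite sub0r => /eqP; rewrite oppr_eq0 => /eqP.
  have [/gb''//|ki] := boolP (k \in [set i]).
  by rewrite -bb'' // gb // in_setC.
(* The line of w_k has dimension 1, which is exactly the strictness of [rank_gt]. *)
have indep k : independent (0 + <[w k]>) K.
  move=> G sGK; rewrite add0v dim_vline w_neq0 /=.
  have [->|G0] := eqVneq G set0.
    by rewrite cards0 addn0 /form_span big_set0 addv0 dim_vline w_neq0.
  apply: leq_trans (dimvS (addvSr _ _)); apply: rank_gt => //.
  apply/set0Pn; exists i; rewrite in_setC; apply/negP => /(subsetP sGK).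
  by rewrite in_setC in_set1 eqxx.
have reg k p : ideal0 K (lin (w k) * p) -> ideal0 K p.
  by apply: lin_regular; rewrite // memv0.
have reg_wprod p : ideal0 K (wprod K * p) -> ideal0 K p.
  rewrite /wprod; elim/big_rec: _ p => [p|k y _ IH p]; first by rewrite mul1r.
  by rewrite -mulrA => /reg/IH.
elim: M => [|M IH]; first by rewrite mul1r.
by rewrite exprS -mulrA => /reg_wprod/IH.
Qed.

End AlgebraPoint.

End Forms.

(** * Configurations and their matroids *)

Lemma mxrank_le_dim (F : fieldType) p N (M : 'M[F]_(p, N))
    (U : {vspace 'rV[F]_N}) :
  (forall i, row i M \in U) -> (\rank M <= \dim U)%N.
Proof.
move=> MU; pose X := vbasis U.
pose C := \matrix_(i < p, j < \dim U) coord X j (row i M).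
pose D := \matrix_(j < \dim U) X`_j.
rewrite (_ : M = C *m D) ?mulmx_max_rank //; apply/row_matrixP => i.
rewrite row_mul mulmx_sum_row {1}(coord_vbasis (MU i)).
by apply: eq_bigr => j _; rewrite rowK !mxE.
Qed.

Section Configuration.
Variables (F : fieldType) (n : nat) (W : {vspace 'rV[F]_n}).

(** A square matrix whose rows span [W]; the rows of [perp_mx] span the annihilator of [W]. *)
Definition conf_mx : 'M[F]_n := lin1_mx (projv W).
Definition perp_mx : 'M[F]_n := kermx conf_mx^T.

Lemma mem_conf_mx (v : 'rV[F]_n) : (v \in W) = (v <= conf_mx)%MS.
Proof.
apply/idP/idP => [vW|/submxP[x ->]]; last by rewrite mul_rV_lin1 memv_proj.
by rewrite -(projv_id vW) -mul_rV_lin1 submxMl.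
Qed.

Lemma sum_mulmx_tr (g v : 'rV[F]_n) : (g *m v^T) 0 0 = \sum_i g 0 i * v 0 i.
Proof. by rewrite mxE; apply: eq_bigr => i _; rewrite mxE. Qed.

Lemma annihilator_perp_mx (g : 'rV[F]_n) : annihilator W g <-> (g <= perp_mx)%MS.
Proof.
split=> [gW|/sub_kermxP gB v].
  apply/sub_kermxP/rowP => k; rewrite [RHS]mxE.
  rewrite -[RHS](gW (row k conf_mx)) ?mem_conf_mx ?row_sub // !mxE.
  by apply: eq_bigr => i _; rewrite !mxE.
rewrite mem_conf_mx -sum_mulmx_tr => /submxP[x ->].
by rewrite trmx_mul mulmxA gB mul0mx mxE.
Qed.

(** The double annihilator contains [W] and has the same rank. *)
Lemma mem_perp_perp_mx (v : 'rV[F]_n) :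
  (forall g : 'rV[F]_n, (g <= perp_mx)%MS -> \sum_i g 0 i * v 0 i = 0) -> v \in W.
Proof.
move=> vP; have Q0 : perp_mx *m conf_mx^T = 0 by apply: mulmx_ker.
have sBQ : (conf_mx <= kermx perp_mx^T)%MS.
  by apply/sub_kermxP/trmx_inj; rewrite trmx_mul trmxK Q0 !trmx0.
have /eqmxP eqB : (conf_mx == kermx perp_mx^T)%MS.
  rewrite -(geq_leqif (mxrank_leqif_eq sBQ)) mxrank_ker mxrank_tr /perp_mx.
  by rewrite mxrank_ker mxrank_tr subKn ?rank_leq_col.
rewrite mem_conf_mx eqB; apply/sub_kermxP/rowP => k; rewrite [RHS]mxE.
rewrite -[RHS](vP (row k perp_mx)) ?row_sub // !mxE.
by apply: eq_bigr => i _; rewrite !mxE mulrC.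
Qed.

Definition mask_mx (G : {set 'I_n}) : 'M[F]_n := diag_mx (\row_k (k \in G)%:R).

Lemma mul_maskE G (v : 'rV[F]_n) k : (v *m mask_mx G) 0 k = v 0 k *+ (k \in G).
Proof. by rewrite mul_mx_diag !mxE mulr_natr. Qed.

Lemma col_mul_mask p (M : 'M[F]_(p, n)) G k :
  col k (M *m mask_mx G) = if k \in G then col k M else 0.
Proof.
apply/colP => i; rewrite mxE mul_mx_diag !mxE mulr_natr.
by case: ifP => _; rewrite !mxE.
Qed.

Lemma mask_idem G : mask_mx G *m mask_mx G = mask_mx G.
Proof.
rewrite mulmx_diag; congr diag_mx; apply/rowP => k.
by rewrite !mxE -natrM mulnb andbb.
Qed.

Lemma maskC G : mask_mx (~: G) = 1%:M - mask_mx G.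
Proof.
rewrite -diag_const_mx -raddfB /=; congr diag_mx; apply/rowP => k.
by rewrite !mxE in_setC; case: (k \in G); rewrite (subrr, subr0).
Qed.

Lemma leq_rank_mask (G : {set 'I_n}) : (#|G| <= \rank (mask_mx G))%N.
Proof.
pose E : 'M[F]_(#|G|, n) := rowsub enum_val 1%:M.
have EDE : E *m mask_mx G *m E^T = 1%:M.
  apply/matrixP => i j; rewrite mul_mx_diag !mxE (bigD1 (enum_val i)) //=.
  rewrite !mxE eqxx enum_valP !mul1r (inj_eq enum_val_inj) eq_sym.
  rewrite big1 ?addr0 // => k /negPf ki.
  by rewrite !mxE [_ == k]eq_sym ki !mul0r.
rewrite -[X in (X <= _)%N](mxrank1 F) -EDE.
exact: leq_trans (mxrankM_maxl _ _) (mxrankM_maxr _ _).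
Qed.

Lemma sub_mask p (M : 'M[F]_(p, n)) G : (M <= mask_mx G)%MS -> M *m mask_mx G = M.
Proof. by move=> /submxP[x ->]; rewrite -mulmxA mask_idem. Qed.

(** Let D be the projection to the coordinates in [G]. The part of the annihilator of [W] killed by
    D annihilates [W] + im D, which bounds its rank. Rank-nullity for both products then forces [W]
    to be the sum of its intersections with im D and ker D. *)
Lemma mask_stable_of_rank G :
    (\rank (conf_mx *m mask_mx G) + \rank (perp_mx *m mask_mx G) <= #|G|)%N ->
  forall v, v \in W -> v *m mask_mx G \in W.
Proof.
set B := conf_mx; set Q := perp_mx; set D := mask_mx G => rankG.
have DT : D^T = D by rewrite tr_diag_mx.
have rankB := mxrank_mul_ker B D; have rankQ := mxrank_mul_ker Q D.
have rank_capQ : (\rank (Q :&: kermx D) + \rank (B + D) <= n)%N.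
  have sQ : (Q :&: kermx D <= kermx (row_mx B^T D))%MS.
    apply/sub_kermxP; rewrite mul_mx_row.
    have /sub_kermxP-> := capmxSl Q (kermx D).
    by have /sub_kermxP-> := capmxSr Q (kermx D); rewrite row_mx0.
  apply: leq_trans (leq_add (mxrankS sQ) (leqnn _)) _; rewrite mxrank_ker.
  rewrite -(mxrank_tr (row_mx _ _)) tr_row_mx trmxK DT addsmxE subnK //.
  exact: rank_leq_col.
have rankQ' : \rank Q = (n - \rank B)%N by rewrite mxrank_ker mxrank_tr.
have capDker : (D :&: kermx D)%MS = 0.
  by rewrite -(sub_mask (capmxSl D (kermx D))); apply/sub_kermxP/capmxSr.
pose S := ((B :&: D) + (B :&: kermx D))%MS.
have rankS : \rank S = (\rank (B :&: D) + \rank (B :&: kermx D))%N.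
  apply: mxrank_disjoint_sum; apply/eqP; rewrite -submx0 -capDker.
  by apply: capmxS; apply: capmxSr.
have SB : (S <= B)%MS by rewrite addsmx_sub !capmxSl.
have leB : (\rank B <= \rank S)%N.
  have := mxrank_sum_cap B D; have := leq_rank_mask G; have := rank_leq_col B.
  rewrite -/D in rankG *; lia.
have BS : (B <= S)%MS by rewrite -(geq_leqif (mxrank_leqif_sup SB)).
move=> v; rewrite !mem_conf_mx => /submx_trans/(_ BS)/sub_addsmxP[[x y] /= ->].
rewrite mulmxDl -!mulmxA (sub_mask (capmxSr _ _)).
have /sub_kermxP-> := capmxSr B (kermx D).
by rewrite mulmx0 addr0 mulmx_sub // capmxSl.
Qed.

Lemma config_basisP (B : {set 'I_n}) : config_basis W B <->
  (forall v, v \in W -> (forall i, i \in B -> v 0 i = 0) -> v = 0) /\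
  (forall c : 'rV[F]_n, exists2 v, v \in W & forall i, i \in B -> v 0 i = c 0 i).
Proof.
split=> [[f fK Kf]|[inj surj]].
  split=> [v vW v0|c]; last first.
    pose h : {ffun {i | i \in B} -> F} := [ffun i => c 0 (val i)].
    exists (vsval (f h)); first exact: subvsP.
    move=> i iB; have := congr1 (fun g : {ffun _} => g (exist _ i iB)) (Kf h).
    by rewrite !ffunE.
  rewrite -(vsprojK vW) -(linear0 (vsval : subvs_of W -> _)); congr vsval.
  apply: (can_inj fK); apply/ffunP => i; rewrite !ffunE linear0 vsprojK // mxE.
  exact: v0 (valP i).
have ex (h : {ffun {i | i \in B} -> F}) : exists v : subvs_of W, coord_proj B v == h.
  pose c := \row_i (if insub i is Some j then h j else 0).
  have [v vW vc] := surj c; exists (vsproj W v); apply/eqP/ffunP => i.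
  by rewrite ffunE vsprojK // vc ?(valP i) // mxE valK.
exists (fun h => xchoose (ex h)) => [v|h]; last exact/eqP/(xchooseP (ex h)).
have /eqP/ffunP eqv := xchooseP (ex (coord_proj B v)).
apply/val_inj/eqP; rewrite -subr_eq0 -[val _ - val _]/(vsval _ - vsval v).
rewrite -linearB; apply/eqP/inj => [|i iB]; first exact: subvsP.
by have := eqv (exist _ i iB); rewrite !ffunE linearB !mxE => ->; rewrite subrr.
Qed.

(** A stable [W] is the direct sum of its restrictions to [G] and to the complement, which would
    split the matroid. *)
Lemma connected_not_mask_stable (G : {set 'I_n}) :
    matroid_connected (config_basis W) -> G != set0 -> ~: G != set0 ->
  ~ (forall v, v \in W -> v *m mask_mx G \in W).
Proof.
move=> conn G0 CG0 stab; apply: conn.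
have stabC v : v \in W -> v *m mask_mx (~: G) \in W.
  by move=> vW; rewrite maskC mulmxBr mulmx1 memvB ?stab.
have split_mask (v : 'rV[F]_n) : v = v *m mask_mx G + v *m mask_mx (~: G).
  by rewrite maskC mulmxBr mulmx1 addrC subrK.
(* The two families consist of the traces of bases on [G] and on its complement. *)
exists G, (fun B1 : {set 'I_n} => B1 \subset G /\ exists2 B2 : {set 'I_n},
  B2 \subset ~: G & config_basis W (B1 :|: B2)),
  (fun B2 : {set 'I_n} => B2 \subset ~: G /\ exists2 B1 : {set 'I_n},
  B1 \subset G & config_basis W (B1 :|: B2)).
split=> // [B1 []//|B2 []//|B]; split=> [bB|].
  exists (B :&: G), (B :&: ~: G); rewrite -setIUr setUCr setIT; split=> //.
    split; first exact: subsetIr.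
    by exists (B :&: ~: G); rewrite ?subsetIr // -setIUr setUCr setIT.
  split; first exact: subsetIr.
  by exists (B :&: G); rewrite ?subsetIr // -setIUr setUCr setIT.
(* The traces come from two possibly different bases: the first controls the coordinates in [G], the
   second those outside. *)
move=> [B1 [B2' [[sB1 [B2 sB2 /config_basisP[inj surj]]]]]].
move=> [sB2' [B1' sB1' /config_basisP[inj' surj']]] ->.
have inG (H : {set 'I_n}) i : H \subset G -> i \in H -> i \in G.
  by move=> /subsetP; apply.
have ninG (H : {set 'I_n}) i : H \subset ~: G -> i \in H -> i \in G = false.
  by move=> /subsetP sH /sH; rewrite in_setC => /negPf.
apply/config_basisP; split=> [v vW v0|c].
  have vG : v *m mask_mx G = 0.
    apply: inj (stab _ vW) _ => i; rewrite mul_maskE; case/setUP => iB.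
      by rewrite v0 ?mul0rn // in_setU iB.
    by rewrite (ninG _ _ sB2 iB) mulr0n.
  have vCG : v *m mask_mx (~: G) = 0.
    apply: inj' (stabC _ vW) _ => i; rewrite mul_maskE in_setC; case/setUP => iB.
      by rewrite (inG _ _ sB1' iB) mulr0n.
    by rewrite v0 ?mul0rn // in_setU iB orbT.
  by rewrite (split_mask v) vG vCG addr0.
have [v vW vc] := surj c; have [v' v'W v'c] := surj' c.
exists (v *m mask_mx G + v' *m mask_mx (~: G)); first by rewrite memvD ?stab ?stabC.
move=> i; rewrite mxE !mul_maskE in_setC; case/setUP => iB.
  by rewrite (inG _ _ sB1 iB) mulr1n mulr0n addr0 vc // in_setU iB.
by rewrite (ninG _ _ sB2' iB) mulr0n mulr1n add0r v'c // in_setU iB orbT.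
Qed.

(** The parameter space is two copies of F^n, mapped onto [W] and its annihilator by [conf_mx] and
    [perp_mx]; [wform k] and [uform k] are the pullbacks of the k-th coordinates. *)
Definition wform k : 'rV[F]_(n + n) := row_mx (col k conf_mx)^T 0.
Definition uform k : 'rV[F]_(n + n) := row_mx 0 (col k perp_mx)^T.

Lemma connected_rank_gt (G : {set 'I_n}) :
    matroid_connected (config_basis W) -> G != set0 -> ~: G != set0 ->
  (#|G| < \dim (form_span wform uform G))%N.
Proof.
move=> conn G0 CG0; rewrite ltnNge; apply/negP => le_dim.
apply: (connected_not_mask_stable conn G0 CG0); apply: mask_stable_of_rank.
apply: leq_trans le_dim.
(* The transposes form a block diagonal matrix whose rows are the [wform k] and [uform k] for k in
   [G], and zeros. *)
rewrite -(mxrank_tr (conf_mx *m _)) -(mxrank_tr (perp_mx *m _)).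
rewrite -rank_diag_block_mx; apply: mxrank_le_dim => i.
have sub_span k v : k \in G -> v \in (<[wform k]> + <[uform k]>)%VS ->
    v \in form_span wform uform G.
  by move=> kG; apply/subvP/(sumv_sup k).
case: (split_ordP i) => k ->; rewrite block_mxEv.
  rewrite rowKu row_row_mx row0 -tr_col col_mul_mask.
  case: ifP => kG; last by rewrite trmx0 row_mx0 mem0v.
  by apply: sub_span kG _; rewrite memvE addvSl.
rewrite rowKd row_row_mx row0 -tr_col col_mul_mask.
case: ifP => kG; last by rewrite trmx0 row_mx0 mem0v.
by apply: sub_span kG _; rewrite memvE addvSr.
Qed.

(** For a singleton the rank is at least 2, so neither form spans a zero line: the matroid has no
    loop and no coloop. *)
Lemma connected_form_neq0 k : (1 < n)%N -> matroid_connected (config_basis W) ->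
  wform k != 0 /\ uform k != 0.
Proof.
move=> n_gt1 conn; have := @connected_rank_gt [set k] conn.
rewrite cards1 /form_span big_set1 => dim_gt1.
have {dim_gt1} : (1 < \dim (<[wform k]> + <[uform k]>))%N.
  apply: dim_gt1; first by apply/set0Pn; exists k; rewrite in_set1.
  by rewrite -card_gt0 cardsC1 card_ord -subn1 subn_gt0.
move=> /leq_trans/(_ (dimv_add_leqif _ _)); rewrite !dim_vline.
by case: (_ != 0); case: (_ != 0).
Qed.

End Configuration.

(** * Points of Lambda *)

Section AlgebraPoints.
Variables (F : fieldType) (n : nat) (W : {vspace 'rV[F]_n}).
Variable A : comUnitAlgType F.
Implicit Types x w b : 'rV[A]_n.
Local Notation alg_mx := (map_mx (GRing.in_alg A : {rmorphism F -> A})).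
Local Notation B := (conf_mx W).
Local Notation Q := (perp_mx W).

Lemma mulmx_algE q (M : 'M[F]_(n, q)) w k :
  (w *m alg_mx M) 0 k = \sum_i M i k *: w 0 i.
Proof. by rewrite mxE; apply: eq_bigr => i _; rewrite mxE /= mulr_algr. Qed.

(** The columns of [pinvmx B *m B - 1] annihilate [W], so they are among the equations that hold for
    points over any algebra. *)
Lemma W_points_pinv w :
  W_points W w -> w *m alg_mx (pinvmx B) *m alg_mx B = w.
Proof.
move=> Ww; apply/eqP; rewrite -mulmxA -map_mxM -subr_eq0 -[X in _ - X]mulmx1.
rewrite -(map_mx1 (GRing.in_alg A : {rmorphism F -> A})) -mulmxBr -map_mxB.
set M := _ - 1%:M; apply/eqP/rowP => k; rewrite mulmx_algE [RHS]mxE.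
rewrite -[RHS](Ww (col k M)^T); first by apply: eq_bigr => i _; rewrite !mxE.
move=> v; rewrite mem_conf_mx => vB.
have vM : v *m M = 0 by rewrite mulmxBr mulmxA mulmxKpV // mulmx1 subrr.
have := congr1 (fun y : 'rV[F]_n => y 0 k) vM; rewrite mxE [RHS]mxE => vMk.
by rewrite -[RHS]vMk; apply: eq_bigr => i _; rewrite mxE [in LHS]mxE mulrC.
Qed.

Lemma Wperp_points_pinv b :
  Wperp_points W b -> b *m alg_mx (pinvmx Q) *m alg_mx Q = b.
Proof.
move=> Wb; apply/eqP; rewrite -mulmxA -map_mxM -subr_eq0 -[X in _ - X]mulmx1.
rewrite -(map_mx1 (GRing.in_alg A : {rmorphism F -> A})) -mulmxBr -map_mxB.
set M := _ - 1%:M; apply/eqP/rowP => k; rewrite mulmx_algE [RHS]mxE.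
rewrite -[RHS](Wb (col k M)^T); first by apply: eq_bigr => i _; rewrite !mxE.
apply: mem_perp_perp_mx => v vQ.
have vM : v *m M = 0 by rewrite mulmxBr mulmxA mulmxKpV // mulmx1 subrr.
have := congr1 (fun y : 'rV[F]_n => y 0 k) vM; rewrite mxE [RHS]mxE => vMk.
by rewrite -[RHS]vMk; apply: eq_bigr => i _; rewrite mxE [in LHS]mxE.
Qed.

Lemma W_points_mul x : W_points W (x *m alg_mx B).
Proof.
move=> g /annihilator_perp_mx/sub_kermxP gB.
have -> : \sum_i g 0 i *: (x *m alg_mx B) 0 i = (x *m alg_mx B *m alg_mx g^T) 0 0.
  by rewrite mulmx_algE; apply: eq_bigr => i _; rewrite [g^T _ _]mxE.
rewrite -mulmxA -map_mxM -[B]trmxK -trmx_mul gB trmx0.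
by rewrite map_mx0 mulmx0 mxE.
Qed.

Lemma Wperp_points_mul x : Wperp_points W (x *m alg_mx Q).
Proof.
move=> v; rewrite mem_conf_mx => /submxP[y def_v].
have -> : \sum_i v 0 i *: (x *m alg_mx Q) 0 i = (x *m alg_mx Q *m alg_mx v^T) 0 0.
  by rewrite mulmx_algE; apply: eq_bigr => i _; rewrite [v^T _ _]mxE.
rewrite -mulmxA -map_mxM def_v trmx_mul mulmxA mulmx_ker mul0mx.
by rewrite map_mx0 mulmx0 mxE.
Qed.

Lemma alg_eval_wform x1 x2 b k :
  alg_eval (row_mx x1 x2) b (lin n (wform W k)) = (x1 *m alg_mx B) 0 k.
Proof.
rewrite alg_eval_lin big_split_ord mulmx_algE /= [X in _ + X]big1 ?addr0.
  by apply: eq_bigr => i _; rewrite !row_mxEl !mxE.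
by move=> i _; rewrite !row_mxEr mxE scale0r.
Qed.

Lemma alg_eval_uform x1 x2 b k :
  alg_eval (row_mx x1 x2) b (lin n (uform W k)) = (x2 *m alg_mx Q) 0 k.
Proof.
rewrite alg_eval_lin big_split_ord mulmx_algE /= [X in X + _]big1 ?add0r.
  by apply: eq_bigr => i _; rewrite !row_mxEr !mxE.
by move=> i _; rewrite !row_mxEl mxE scale0r.
Qed.

Lemma Lambda_hat_graph x1 x2 b :
    (forall k, (x1 *m alg_mx B) 0 k * b 0 k = (x2 *m alg_mx Q) 0 k) ->
  Lambda_hat W (x1 *m alg_mx B, b).
Proof.
move=> eq_graph; split; first exact: W_points_mul.
move=> v vW; rewrite -[RHS](Wperp_points_mul x2 vW) /=.
by apply: eq_bigr => i _; rewrite -eq_graph mulrC.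
Qed.

(** The products beta_i w_i form a point of the annihilator of [W], so both [w] and these products
    have parameters. *)
Lemma Lambda_hat_graph_ex p : Lambda_hat W p -> exists x1 x2,
  p.1 = x1 *m alg_mx B /\
  forall k, (x1 *m alg_mx B) 0 k * p.2 0 k = (x2 *m alg_mx Q) 0 k.
Proof.
move=> [Wp Lp]; exists (p.1 *m alg_mx (pinvmx B)).
pose y := \row_i (p.2 0 i * p.1 0 i); exists (y *m alg_mx (pinvmx Q)).
rewrite W_points_pinv // Wperp_points_pinv => [|v vW].
  by split=> // k; rewrite mxE mulrC.
by rewrite -[RHS](Lp v vW); apply: eq_bigr => i _; rewrite mxE.
Qed.

(** The comorphism of the map sending parameters [x1], [x2] and [b] to the pair of [x1 *m conf_mx]
    and [b]. *)
Definition pullback : {mpoly F[n + n]} -> {mpoly F[(n + n) + n]} :=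
  mmap (@mpolyC (n + n + n) F) (fun i =>
    match split i with inl k => lin n (wform W k) | inr k => beta F (n + n) k end).
HB.instance Definition _ := GRing.RMorphism.on pullback.

Lemma alg_eval_pullback x1 x2 b f :
  alg_eval (row_mx x1 x2) b (pullback f) = poly_eval f (x1 *m alg_mx B, b).
Proof.
pose f1 : {rmorphism {mpoly F[n + n]} -> A} :=
  alg_eval (row_mx x1 x2) b \o pullback.
pose f2 : {rmorphism {mpoly F[n + n]} -> A} := alg_eval (x1 *m alg_mx B) b.
apply: (@rmorph_mpoly_eq _ _ _ f1 f2) => [c|i]; rewrite /f1 /f2 /=.
  by rewrite /pullback mmapC !alg_evalC.
rewrite alg_evalX /pullback mmapXi; case: (split_ordP i) => k ->.
  by rewrite alg_eval_wform row_mxEl.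
by rewrite alg_evalX !row_mxEr.
Qed.

Lemma torus_unimodular w : (0 < n)%N -> torus w -> unimodular w.
Proof.
case: n w => // m w _ wU; exists (\row_i (if i == 0 then (w 0 0)^-1 else 0)).
rewrite (bigD1 0) //= mxE eqxx mulVr // big1 ?addr0 // => i /negPf i0.
by rewrite mxE i0 mul0r.
Qed.

(** The elements with a power killing [z] form an ideal, and the coordinates of a unimodular vector
    generate the unit ideal. *)
Lemma nilpotent_unimodular (a w : 'rV[A]_n) (z : A) :
    \sum_i a 0 i * w 0 i = 1 -> (forall i, exists N, w 0 i ^+ N * z = 0) ->
  z = 0.
Proof.
move=> a1 wz; suff [N] : exists N, (\sum_i a 0 i * w 0 i) ^+ N * z = 0.
  by rewrite a1 expr1n mul1r.
elim/big_ind: _ => [|y y' [N yz] [N' y'z]|i _].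
- by exists 1; rewrite expr1 mul0r.
- exists (N + N'); rewrite exprDn mulr_suml big1 // => j _.
  rewrite mulrnAl; have [le_N'j|lt_jN'] := leqP N' j.
    have y'jz : y' ^+ j * z = 0.
      by rewrite -(subnK le_N'j) exprD -mulrA y'z mulr0.
    by rewrite -mulrA y'jz mulr0 mul0rn.
  have le_N : (N <= N + N' - j)%N by lia.
  have ykz : y ^+ (N + N' - j) * z = 0.
    by rewrite -(subnK le_N) exprD -mulrA yz mulr0.
  by rewrite mulrAC ykz mul0r mul0rn.
by have [N wN] := wz i; exists N; rewrite exprMn -mulrA wN mulr0.
Qed.

End AlgebraPoints.

(** * The isomorphisms given by the torus action *)

Section TorusPart.
Variables (F : fieldType) (n : nat) (W : {vspace 'rV[F]_n}).
Hypothesis n_gt0 : (0 < n)%N.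

Lemma dual_actE (A : comUnitAlgType F) (u b : 'rV[A]_n) i :
  dual_act u b 0 i = b 0 i / u 0 i.
Proof. by rewrite mxE. Qed.

Lemma act_map_Lambda_hat (A : comUnitAlgType F) (w b : 'rV[A]_n) :
    W_points W w -> Wperp_points W b -> torus w -> torus b ->
  Lambda_hat W (act_map (w, b)) /\ torus (dual_act w b).
Proof.
move=> Ww Wb wU bU; split; last first.
  by move=> i; rewrite dual_actE unitrM unitrV bU wU.
split=> // v vW; rewrite -[RHS](Wb v vW); apply: eq_bigr => i _.
by rewrite dual_actE divrK.
Qed.

Definition act_inv (A : comUnitAlgType F) (p : points n A) : points n A :=
  (p.1, \row_i (p.2 0 i * p.1 0 i)).

Lemma act_map_inv (A : comUnitAlgType F) (p : points n A) :
  torus p.1 -> act_map (act_inv p) = p.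
Proof.
case: p => w b /= wU; congr pair; apply/rowP => i.
by rewrite dual_actE mxE mulrK.
Qed.

Lemma act_inv_points (A : comUnitAlgType F) (p : points n A) :
    Lambda_hat W p -> torus p.1 -> torus p.2 ->
  Wperp_points W (act_inv p).2 /\ torus (act_inv p).2.
Proof.
move=> [_ Lp] wU bU; split=> [v vW|i]; last by rewrite mxE unitrM bU wU.
by rewrite -[RHS](Lp v vW); apply: eq_bigr => i _; rewrite mxE.
Qed.

Lemma act_map_inj (A : comUnitAlgType F) (p q : points n A) :
  torus p.1 -> torus q.1 -> act_map p = act_map q -> p = q.
Proof.
case: p q => [w b] [w' b'] /= wU wU' [<- eq_b]; congr pair; apply/rowP => i.
by have /rowP/(_ i) := eq_b; rewrite !dual_actE => /(mulIr _)->//; rewrite unitrV.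
Qed.

Lemma act_map_iso_affine : induces_iso (@affine_eq F n) (@act_map F n)
  (prod_sub (W_circ W) (Wperp_circ W)) (Lambda_hat_circ W).
Proof.
move=> A; split.
- move=> [w b] [/= [Ww wU] [Wb bU]].
  by have [] := act_map_Lambda_hat Ww Wb wU bU.
- by move=> p q _ _ ->.
- by move=> p q [[_ pU] _] [[_ qU] _]; apply: act_map_inj.
move=> q [Lq [wU bU]]; exists (act_inv q); last exact: act_map_inv.
by have [Wb bU'] := act_inv_points Lq wU bU; split; split => //; case: Lq.
Qed.

Lemma act_map_iso_proj : induces_iso (@proj_eq F n) (@act_map F n)
  (prod_sub (PW_circ W) (PWperp_circ W)) (Lambda_circ W).
Proof.
move=> A; split.
- move=> [w b] [/= [[Ww uw] wU] [[Wb ub] bU]].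
  have [L tU] := act_map_Lambda_hat Ww Wb wU bU.
  by split; split => //; split => //; apply: torus_unimodular.
- move=> [w b] q [/= [_ wU] _] _ [c [d [cU dU ->]]].
  (* The action divides beta by w, hence its scaling factor [d] by [c]. *)
  exists c, (d / c); split; rewrite ?unitrM ?unitrV ?cU ?dU //.
  by congr pair; apply/rowP => i; rewrite !mxE invrM ?wU // [_^-1 * _]mulrC mulrACA.
- move=> [w b] [w' b'] [/= [_ wU] _] [/= [_ wU'] _] [c [d [cU dU /= [ew eb]]]].
  exists c, (d * c); split; rewrite ?unitrM ?cU ?dU // ew; congr pair.
  apply/rowP => i; have /rowP/(_ i) := eb; rewrite !mxE ew mxE => eqb.
  have cwU : c * w 0 i \is a GRing.unit by rewrite unitrM cU wU.
  rewrite -[LHS](divrK cwU) eqb; rewrite -!mulrA; congr (_ * _).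
  by rewrite (mulrCA _ c) mulVr // mulr1 mulrC.
move=> q [[Lq _] [wU bU]].
have [Wb bU'] := act_inv_points Lq wU bU.
exists (act_inv q).
  by split; (split; [split|]) => //; try exact: torus_unimodular; case: Lq.
by exists 1, 1; rewrite act_map_inv // !scale1r unitr1; case: (q).
Qed.

End TorusPart.

(** * Smoothness by infinitesimal lifting *)

Section Smooth.
Variables (F : fieldType) (n : nat) (W : {vspace 'rV[F]_n}).
Hypothesis n_gt0 : (0 < n)%N.

Local Notation alg_mx A := (map_mx (GRing.in_alg A : {rmorphism F -> A})).

(** If [a * a' = 1 + e] with [e] of square zero, then [a' * (1 - e)] inverts [a]. *)
Lemma unit_lift (A B : comUnitRingType) (pi : {rmorphism A -> B}) a :
    (forall b, exists a, pi a = b) ->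
    (forall a a', pi a = 0 -> pi a' = 0 -> a * a' = 0) ->
  pi a \is a GRing.unit -> a \is a GRing.unit.
Proof.
move=> surj sqz aU; have [a' a'E] := surj (pi a)^-1.
have e0 : pi (a * a' - 1) = 0 by rewrite rmorphB rmorphM rmorph1 a'E mulrV ?subrr.
apply/unitrPr; exists (a' * (1 - (a * a' - 1))).
have := sqz _ _ e0 e0 => sq; rewrite mulrA.
set e := a * a' - 1 in sq *; have -> : a * a' = 1 + e by rewrite addrC subrK.
by rewrite -[RHS]subr0 -sq; ring.
Qed.

(** The parameters [x1] and [x2] range over affine space and lift freely; the lifted w_k and u_k
    stay units, so beta_k can be taken to be u_k / w_k. *)
Lemma Lambda_circ_smooth : smooth_over_base (@proj_eq F n) (Lambda_circ W).
Proof.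
move=> A B pi surj sqz q [[Lq _] [wU bU]].
have [y1 [y2 [eqw eqg]]] := Lambda_hat_graph_ex Lq.
have lift (y : 'rV[B]_n) : exists x : 'rV[A]_n, map_mx pi x = y.
  have /fin_all_exists[f fP] i : exists a, pi a = y 0 i by apply: surj.
  by exists (\row_i f i); apply/rowP => i; rewrite !mxE.
have [x1 x1E] := lift y1; have [x2 x2E] := lift y2.
have pi_mx (x : 'rV[A]_n) (M : 'M[F]_n) :
    map_mx pi (x *m alg_mx A M) = map_mx pi x *m alg_mx B M.
  rewrite map_mxM; congr (_ *m _); apply/matrixP => i j; rewrite !mxE /=.
  by rewrite linearZ rmorph1.
pose w := x1 *m alg_mx A (conf_mx W); pose u := x2 *m alg_mx A (perp_mx W).
have piw : map_mx pi w = q.1 by rewrite pi_mx x1E eqw.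
have piu k : pi (u 0 k) = q.1 0 k * q.2 0 k.
  by rewrite eqw eqg -x2E -pi_mx [RHS]mxE.
have piwk k : pi (w 0 k) = q.1 0 k by rewrite -piw [RHS]mxE.
have unitw k : w 0 k \is a GRing.unit.
  by apply: unit_lift surj sqz _; rewrite /= piwk.
have unitu k : u 0 k \is a GRing.unit.
  by apply: unit_lift surj sqz _; rewrite /= piu unitrM wU bU.
pose b := \row_k (u 0 k / w 0 k).
have unitb : torus b by move=> k; rewrite [b _ _]mxE unitrM unitrV unitw unitu.
exists (w, b) => /=.
  split; last by [].
  split; last by split; apply: torus_unimodular.
  by apply: (@Lambda_hat_graph _ _ _ _ x1 x2) => k; rewrite [b _ _]mxE mulrC divrK.
exists 1, 1; rewrite unitr1 !scale1r piw; split => //=.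
rewrite (_ : map_mx pi b = q.2); first by case: (q).
by apply/rowP => k; rewrite [LHS]mxE [b _ _]mxE rmorphM rmorphV //= piu piwk mulrC mulKr.
Qed.

End Smooth.

(** * Irreducibility and closure for a connected matroid *)

Section Connected.
Variables (F : fieldType) (n : nat) (W : {vspace 'rV[F]_n}).
Hypothesis infF : forall s : seq F, exists c, c \notin s.
Hypothesis n_gt1 : (1 < n)%N.
Hypothesis connW : matroid_connected (config_basis W).

Let n_gt0 : (0 < n)%N. Proof. exact: ltnW. Qed.
Let w_neq0 k : wform W k != 0.
Proof. by case: (connected_form_neq0 k n_gt1 connW). Qed.
Let u_neq0 k : uform W k != 0.
Proof. by case: (connected_form_neq0 k n_gt1 connW). Qed.

Local Notation vanishing := (vanish_on_graph (wform W) (uform W) setT).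

Lemma poly_evalE (A : comUnitAlgType F) (f : {mpoly F[n + n]}) (p : points n A) :
  poly_eval f p = alg_eval p.1 p.2 f.
Proof. by []. Qed.

Lemma alg_eval_self m (x : 'rV[F]_m) (b : 'rV[F]_n) g :
  alg_eval (A := F^o) x b g = g.@[pt x b].
Proof.
pose f1 : {rmorphism {mpoly F[m + n]} -> F^o} := alg_eval (A := F^o) x b.
pose f2 : {rmorphism {mpoly F[m + n]} -> F^o} := meval (pt x b).
apply: (@rmorph_mpoly_eq _ _ _ f1 f2) => [c|i]; rewrite /f1 /f2 /=.
  by rewrite alg_evalC mevalC; apply: mulr1.
by rewrite alg_evalX mevalXU.
Qed.

(** The ideal involves points over all algebras but is detected over [F]: generic graph points give
    points of [Lambda_circ W] over [F], and [alg_eval_torus] carries vanishing on the graph to every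
    algebra. *)
Lemma ideal_of_vanishing f :
  ideal_of (Lambda_circ W) f <-> vanishing (pullback W f).
Proof.
split=> [If x b gx gb|Vf A p [[Lp _] [wU bU]]].
  rewrite -(hsubmxK x) in gx gb *; set x1 := lsubmx x in gx gb *.
  set x2 := rsubmx x in gx gb *.
  have evw k := alg_eval_wform W (A := F^o) x1 x2 b k.
  have evu k := alg_eval_uform W (A := F^o) x1 x2 b k.
  rewrite -alg_eval_self alg_eval_pullback; apply: (If F^o).
  set w := x1 *m _ in evw *; set u := x2 *m _ in evu.
  have wE k : w 0 k = dot (wform W k) (row_mx x1 x2).
    by rewrite -evw alg_eval_self meval_lin.
  have uE k : u 0 k = dot (uform W k) (row_mx x1 x2).
    by rewrite -evu alg_eval_self meval_lin.
  have w0 k : w 0 k != 0 by rewrite wE; case: (gx k).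
  have u0 k : u 0 k != 0 by rewrite uE; case: (gx k).
  have bE k : b 0 k = u 0 k / w 0 k by rewrite uE wE gb.
  have wU : torus (A := F^o) w by move=> k; rewrite unitfE.
  have bU : torus (A := F^o) b.
    by move=> k; rewrite unitfE bE mulf_neq0 // invr_eq0.
  split; last by split.
  split; last by split; apply: torus_unimodular.
  apply: (@Lambda_hat_graph F n W F^o x1 x2 b) => k.
  by rewrite -/w -/u bE mulrC divfK.
have [x1 [x2 [p1E eqg]]] := Lambda_hat_graph_ex Lp.
rewrite [p]surjective_pairing p1E -(alg_eval_pullback W x1 x2).
apply: (alg_eval_torus infF w_neq0 u_neq0 _ _ Vf) => k.
  by rewrite alg_eval_wform alg_eval_uform eqg.
by rewrite alg_eval_wform -p1E.
Qed.

Lemma Lambda_hat_zero_locus (A : comUnitAlgType F) (p : points n A) :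
  zero_locus (ideal_of (Lambda_circ W)) p -> Lambda_hat W p.
Proof.
move=> Zp; split=> [g gW|v vW].
  (* The defining equations of [Lambda_hat W] belong to the ideal; [lin n g] is the linear equation
     on V given by [g]. *)
  have := Zp (lin n g); rewrite poly_evalE alg_eval_lin; apply => A' p' [[[Wp' _] _] _].
  by rewrite poly_evalE alg_eval_lin; apply: Wp'.
pose f : {mpoly F[n + n]} := \sum_i v 0 i *: ('X_(rshift n i) * 'X_(lshift n i)).
have fE (A' : comUnitAlgType F) (p' : points n A') :
    poly_eval f p' = \sum_i v 0 i *: (p'.2 0 i * p'.1 0 i).
  rewrite poly_evalE rmorph_sum; apply: eq_bigr => i _ /=.
  rewrite -mul_mpolyC !rmorphM /= alg_evalC !alg_evalX row_mxEl row_mxEr.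
  by rewrite -scalerAl mul1r.
rewrite -fE; apply: Zp => A' p' [[[_ Lp'] _] _].
by rewrite fE; apply: Lp'.
Qed.

Lemma Lambda_circ_very_affine : very_affine_variety (Lambda_circ W).
Proof.
split=> [A p|/ideal_of_vanishing V1|f g /ideal_of_vanishing].
- split=> [Lp|[tp Zp]]; first by split=> [|f]; [case: Lp|apply].
  split=> //; split; first exact: Lambda_hat_zero_locus.
  by case: tp => wU bU; split; apply: torus_unimodular.
(* Every generic [x] has a graph point above it, so vanishing of 1 on the graph would make it the
   zero polynomial. *)
- suff /eqP : (1 : {mpoly F[(n + n) + n]}) = 0 by rewrite oner_eq0.
  apply: (generic_vanish_eq0 infF w_neq0 u_neq0) => x b gx.
  have [b' gb' _] := exists_on_graph (wform W) (uform W) setT x b.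
  by have := V1 x b' gx gb'; rewrite !rmorph1.
rewrite rmorphM => /(vanish_on_graph_prime infF w_neq0 u_neq0).
by case=> /ideal_of_vanishing; [left|right].
Qed.

(** For [f] in the ideal, each w_i has a power killing the value of [f] at a point of [Lambda W];
    unimodularity of w then makes that value zero. *)
Lemma Lambda_circ_closure :
  same_subscheme (proj_closure (Lambda_circ W)) (Lambda W).
Proof.
move=> A p; split=> [[/Lambda_hat_zero_locus Lp up]|[Lp [[a a1] ub]]]; first by split.
split; last by split => //; exists a.
move=> f /ideal_of_vanishing Vf; apply: (nilpotent_unimodular a1) => i.
have [x1 [x2 [p1E eqg]]] := Lambda_hat_graph_ex Lp.
rewrite [p]surjective_pairing p1E -(alg_eval_pullback W x1 x2) /=.
rewrite -(alg_eval_wform W x1 x2 p.2 i).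
apply: (vanish_on_graph_nilpotent infF w_neq0 u_neq0) => // [k|G G0 CG0].
  by rewrite alg_eval_wform alg_eval_uform eqg.
exact: connected_rank_gt.
Qed.

End Connected.

Lemma numField_infinite (F : numFieldType) (s : seq F) : exists c, c \notin s.
Proof.
pose t := [seq i%:R | i <- iota 0 (size s).+1] : seq F.
have uniq_t : uniq t.
  by rewrite map_inj_uniq ?iota_uniq // => i j /eqP; rewrite Num.Theory.eqr_nat => /eqP.
have [/allP st|/allPn[c _ cs]] := boolP (all (mem s) t); last by exists c.
have := uniq_leq_size uniq_t st.
by rewrite size_map size_iota ltnn.
Qed.

Theorem proposition4p4 (R : realType) (n : nat)
    (W : {vspace 'rV[complex R]_n}) (hW : (0 < \dim W < n)%N) :
  [/\ induces_iso (@proj_eq (complex R) n) (@act_map (complex R) n)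
        (prod_sub (PW_circ W) (PWperp_circ W)) (Lambda_circ W),
      induces_iso (@affine_eq (complex R) n) (@act_map (complex R) n)
        (prod_sub (W_circ W) (Wperp_circ W)) (Lambda_hat_circ W)
    & matroid_connected (config_basis W) ->
      [/\ very_affine_variety (Lambda_circ W),
          smooth_over_base (@proj_eq (complex R) n) (Lambda_circ W)
        & same_subscheme (proj_closure (Lambda_circ W)) (Lambda W)]].
Proof.
have n_gt1 : (1 < n)%N by case/andP: hW => /leq_ltn_trans; apply.
have n_gt0 := ltnW n_gt1.
split; [exact: act_map_iso_proj | exact: act_map_iso_affine | move=> connW].
have infC := @numField_infinite (complex R).
split; [ exact: Lambda_circ_very_affine | exact: Lambda_circ_smooth
       | exact: Lambda_circ_closure].
Qed.
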